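(* Let $k\ge2$ and $\ell\ge1$ be integers, let $D\subset(\mathbb{Z}_k)^\ell$ be a $\mathbb{Z}_k$-code (additive subgroup), and let $\Gamma_D=\bigcup_{\xi\in D}N(\xi)\subset(N^\circ)^\ell$. (1) $\Gamma_D$ is a positive definite even lattice if and only if $(\xi|\xi)=0$ for all $\xi\in D$. (2) $\Gamma_D$ is a positive definite odd lattice if and only if $k$ is even, $(\xi|\eta)\in\{0,k/2\}$ for all $\xi,\eta\in D$, and $(\xi|\xi)=k/2$ for some $\xi\in D$.
   Context: $L=\mathbb{Z}\alpha_1+\cdots+\mathbb{Z}\alpha_k$ with $\langle\alpha_i,\alpha_j\rangle=2\delta_{i,j}$, $\gamma=\alpha_1+\cdots+\alpha_k$, $N=\{\alpha\in L\mid\langle\alpha,\gamma\rangle=0\}$ (so $N\cong\sqrt2A_{k-1}$), $N^\circ$ is the dual lattice of $N$ (inside $\mathbb{Q}\otimes N$), and $\lambda_k=\frac1{2k}\gamma-\frac12\alpha_k\in N^\circ$. For $j\in\mathbb{Z}_k$ put $N^{(j)}=N+2j\lambda_k$ (well defined since $2k\lambda_k\in N$). For $\xi=(\xi_1,\dots,\xi_\ell)\in(\mathbb{Z}_k)^\ell$ put $N(\xi)=\{(x_1,\dots,x_\ell)\mid x_r\in N^{(\xi_r)},\ 1\le r\le\ell\}\subset(N^\circ)^\ell$, where $(N^\circ)^\ell$ carries the orthogonal direct sum form. $(\xi|\eta)=\xi_1\eta_1+\cdots+\xi_\ell\eta_\ell\in\mathbb{Z}_k$. An even lattice is an integral lattice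 all of whose elements have even norm $\langle\alpha,\alpha\rangle$; an odd lattice is an integral lattice that is not even. *)

(* Defs.v *)
From HB Require Import structures.
From mathcomp Require Import all_boot all_order all_algebra.
From mathcomp Require Import ring lra.

Set Implicit Arguments.
Unset Strict Implicit.
Unset Printing Implicit Defensive.

Import Order.TTheory GRing.Theory Num.Theory.
Local Open Scope ring_scope.

(* Subsets of a rational vector space V are predicates V -> Prop, and b is the
   ambient symmetric bilinear form. *)
Section Lattices.
Variables (V : lmodType rat) (b : V -> V -> rat).
Implicit Type G : V -> Prop.

(* G is the Z-span of a finite Z-linearly independent family. *)
Definition is_lattice G : Prop :=
  exists (n : nat) (e : 'I_n -> V),
    (forall x, G x <-> exists c : 'I_n -> int, x = \sum_i e i *~ c i) /\
    (forall c : 'I_n -> int, \sum_i e i *~ c i = 0 -> forall i, c i = 0).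

Definition positive_definite G : Prop :=
  forall x, G x -> x != 0 -> 0 < b x x.

Definition integral_lattice G : Prop :=
  is_lattice G /\ forall x y, G x -> G y -> b x y \is a Num.int.

Definition even_lattice G : Prop :=
  integral_lattice G /\ forall x, G x -> exists m : int, b x x = 2 * m%:~R.

Definition odd_lattice G : Prop :=
  integral_lattice G /\ ~ even_lattice G.

Definition rational_span G (x : V) : Prop :=
  exists2 m : nat, (0 < m)%N & G (x *+ m).

Definition dual_lattice G (x : V) : Prop :=
  rational_span G x /\ forall y, G y -> b x y \is a Num.int.

End Lattices.

Section LatticeN.
Variable k : nat.

(* Q (x) L is 'rV[rat]_k, with alpha_1, ..., alpha_k (numbered from 1) as the
   standard basis; alpha i is only meaningful for 1 <= i <= k. *)
Definition alpha (i : nat) : 'rV[rat]_k := \row_(j < k) (j.+1 == i)%:R.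

Definition form (x y : 'rV[rat]_k) : rat := 2 * \sum_(i < k) x 0 i * y 0 i.

Definition latL (x : 'rV[rat]_k) : Prop :=
  exists a : nat -> int, x = \sum_(1 <= i < k.+1) (a i)%:~R *: alpha i.

Definition gamma : 'rV[rat]_k := \sum_(1 <= i < k.+1) alpha i.

Definition latN (x : 'rV[rat]_k) : Prop := latL x /\ form x gamma = 0.

Definition lambda : 'rV[rat]_k :=
  (2 * k%:R)^-1 *: gamma - 2^-1 *: alpha k.

(* N + 2 j lambda_k; it depends only on j modulo k, see cosetN_mod. *)
Definition cosetN (j : int) (x : 'rV[rat]_k) : Prop :=
  exists2 y, latN y & x = y + (2 * j)%:~R *: lambda.

Lemma form_alpha i j : (1 <= i <= k)%N -> (1 <= j <= k)%N ->
  form (alpha i) (alpha j) = 2 * (i == j)%:R.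
Proof.
case: i => [//|i] /= ik; case: j => [//|j] /= jk; congr (_ * _).
rewrite (bigD1 (Ordinal ik)) //= !mxE /= eqxx mul1r big1 ?addr0 // => h hi.
rewrite !mxE eqSS; suff -> : (h == i :> nat) = false by rewrite mul0r.
by apply: contraNF hi => /eqP hi; apply/eqP/val_inj.
Qed.

Lemma latLP x : latL x <-> forall i, x 0 i \is a Num.int.
Proof.
have sumE (a : nat -> rat) (j : 'I_k) :
    (\sum_(1 <= i < k.+1) a i *: alpha i) 0 j = a j.+1.
  rewrite summxE big_add1 /= big_mkord (bigD1 j) //= !mxE eqxx mulr1.
  rewrite big1 ?addr0 // => h hj; rewrite !mxE eqSS.
  suff -> : (j == h :> nat) = false by rewrite mulr0.
  by apply: contraNF hj => /eqP hj; apply/eqP/val_inj.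
split=> [[a ->] i|xZ]; first by rewrite (sumE (fun i => (a i)%:~R)) intr_int.
exists (fun i => if insub i.-1 is Some j then Num.floor (x 0 j) else 0).
apply/rowP => j.
rewrite (sumE (fun i => (if insub i.-1 is Some j then _ else 0)%:~R)) /=.
by rewrite valK; apply/esym/eqP; rewrite -intrEfloor.
Qed.

Lemma gammaE i : gamma 0 i = 1.
Proof.
rewrite /gamma summxE big_add1 /= big_mkord (bigD1 i) //= !mxE eqxx.
rewrite big1 ?addr0 // => h hj; rewrite !mxE eqSS.
suff -> : (i == h :> nat) = false by [].
by apply: contraNF hj => /eqP hj; apply/eqP/val_inj.
Qed.

Lemma latNP x :
  latN x <-> (forall i, x 0 i \is a Num.int) /\ \sum_i x 0 i = 0.
Proof.
have fE : form x gamma = 2 * \sum_i x 0 i.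
  by congr (_ * _); apply: eq_bigr => i _; rewrite gammaE mulr1.
rewrite /latN latLP fE; split=> -[xZ /eqP s]; split=> //; apply/eqP.
  by rewrite mulf_eq0 in s.
by rewrite mulf_eq0 s orbT.
Qed.

Lemma latND x y : latN x -> latN y -> latN (x + y).
Proof.
move=> /latNP[xZ sx] /latNP[yZ sy]; apply/latNP; split=> [i|].
  by rewrite mxE rpredD.
under eq_bigr do rewrite mxE.
by rewrite big_split /= sx sy addr0.
Qed.

Lemma latN_lambda (m : int) : (0 < k)%N -> latN ((2 * k%:Z * m)%:~R *: lambda).
Proof.
move=> k0; have kn0 : k%:R != 0 :> rat by rewrite pnatr_eq0 -lt0n.
have lE i : ((2 * k%:Z * m)%:~R *: lambda) 0 i =
    m%:~R - m%:~R * k%:R * (i.+1 == k)%:R.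
  rewrite !mxE gammaE !intrM -[k%:Z%:~R]/(k%:R : rat).
  by field.
apply/latNP; split=> [i|].
  by rewrite lE rpredB // ?rpredM ?intr_int ?natr_int.
under eq_bigr do rewrite lE.
rewrite sumrB sumr_const card_ord -mulr_sumr.
have -> : \sum_(i < k) (i.+1 == k)%:R = 1 :> rat.
  case: k k0 => // n _; rewrite big_ord_recr /= eqxx big1 ?add0r // => i _.
  by rewrite eqSS ltn_eqF.
by rewrite mulr1 mulr_natr subrr.
Qed.

Lemma cosetN_mod (i j : int) x : (0 < k)%N -> (i = j %[mod k])%Z ->
  cosetN i x -> cosetN j x.
Proof.
move=> k0 /eqP; rewrite eqz_mod_dvd => /dvdzP[q ijq] [y Ny ->].
exists (y + (2 * k%:Z * q)%:~R *: lambda).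
  by apply: latND => //; apply: latN_lambda.
rewrite -addrA -scalerDl -intrD; congr (_ + _%:~R *: _).
by rewrite -(subrK j i) ijq; ring.
Qed.

Lemma cosetN_dual (j : int) x : (0 < k)%N ->
  cosetN j x -> dual_lattice form latN x.
Proof.
move=> k0 [y Ny ->]; have kn0 : k%:R != 0 :> rat by rewrite pnatr_eq0 -lt0n.
split=> [|z /latNP[zZ sz]].
  exists k => //; rewrite mulrnDl; apply: latND.
    elim: {2}k => [|n IH]; last by rewrite mulrS; apply: latND.
    rewrite mulr0n; apply/latNP; split=> [i|]; first by rewrite mxE.
    by rewrite big1 // => i _; rewrite mxE.
  rewrite -scaler_nat scalerA.
  have -> : k%:R * (2 * j)%:~R = (2 * k%:Z * j)%:~R :> rat.
    by rewrite !intrM -[k%:Z%:~R]/(k%:R : rat); ring.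
  exact: latN_lambda.
have [yZ _] := (latNP y).1 Ny.
have -> : form (y + (2 * j)%:~R *: lambda) z = 2 * \sum_i (y 0 i * z 0 i)
    + 2 * (j%:~R / k%:R * \sum_i z 0 i)
    - 2 * \sum_(i < k) (j%:~R * (i.+1 == k)%:R * z 0 i).
  rewrite /form -mulrDr -mulrBr; congr (_ * _).
  rewrite mulr_sumr -big_split -sumrB /=; apply: eq_bigr => i _.
  by rewrite !mxE gammaE !intrM; field.
rewrite sz !mulr0 addr0 rpredB // rpredM ?natr_int // rpred_sum // => i _.
  by rewrite rpredM.
by rewrite !rpredM ?intr_int ?natr_int.
Qed.

End LatticeN.

Section GammaD.
Variables (k l : nat).

(* (Q (x) L)^l is 'M[rat]_(l, k): the component x_r is the r-th row of x. *)
Definition formM (x y : 'M[rat]_(l, k)) : rat :=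
  \sum_(r < l) form (row r x) (row r y).

(* The entry of xi at r is used through its representative in {0, ..., k-1}. *)
Definition latNxi (xi : 'rV['Z_k]_l) (x : 'M[rat]_(l, k)) : Prop :=
  forall r : 'I_l, cosetN (xi 0 r : nat)%:Z (row r x).

Definition GammaD (D : {set 'rV['Z_k]_l}) (x : 'M[rat]_(l, k)) : Prop :=
  exists2 xi, xi \in D & latNxi xi x.

Lemma GammaD_dual D x : (0 < k)%N -> GammaD D x ->
  forall r, dual_lattice (@form k) (@latN k) (row r x).
Proof. by move=> k0 [xi _ xP] r; apply: cosetN_dual (xP r). Qed.

Definition code_dot (xi eta : 'rV['Z_k]_l) : 'Z_k :=
  \sum_(r < l) xi 0 r * eta 0 r.

End GammaD.

(* Main.v *)
From HB Require Import structures.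
Require Import Defs.
From mathcomp Require Import all_boot all_order all_algebra.
From mathcomp Require Import ring zify.
From Stdlib Require Import Classical Wf_nat.

(** The coset [N + 2 j lambda_k] consists of the vectors whose coordinates (in
    the basis alpha) all lie in [j / k + Z] and add up to [0] ([cosetNP]).  For
    [x] in the coset of [i] and [y] in the coset of [j], the vectors
    [x - (i / k) gamma] and [y - (j / k) gamma] have integral coordinates, and
    expanding their standard product, with both coordinate sums zero, gives
    [<x, y> = - 2 i j / k] modulo [2 Z] ([form_cosetN]).  Summing over the rows,
    [<x, y> = - 2 (xi|eta) / k] modulo [2 Z] for [x] in [N(xi)] and [y] in
    [N(eta)] ([formM_latNxi]).  Since every [N(xi)] is inhabited, this turns
    properties of the form on Gamma_D into properties of the code:
    - the form is integral iff [2 (xi|eta) = 0] in Z_k for all codewords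
      ([formM_int]), that is, iff [(xi|eta)] is [0] or, for even k, [k / 2]
      ([Zp_double_eq0]);
    - all norms are even iff [(xi|xi) = 0] for all codewords ([formM_even]).
    If [(xi|xi) = 0] throughout D, polarization gives [2 (xi|eta) = 0], so
    Gamma_D is integral.  Both equivalences then follow by propositional
    reasoning.

    Positive definiteness is automatic, as the ambient form is twice a sum of
    squares.  That Gamma_D is a lattice at all, i.e. has a finite Z-basis, holds
    because it is a subgroup on which the coordinates multiplied by k are
    integral, and any group with finitely many jointly injective integral
    coordinates is free of finite rank ([is_lattice_of_coordinates]). *)

Set Implicit Arguments.
Unset Strict Implicit.
Unset Printing Implicit Defensive.

Import Order.TTheory GRing.Theory Num.Theory.
Local Open Scope ring_scope.

(** * Subgroups with integral coordinates *)

Definition subgroup (V : zmodType) (G : V -> Prop) : Prop :=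
  G 0 /\ forall x y, G x -> G y -> G (x - y).

Section Subgroup.
Variables (V : zmodType) (G : V -> Prop).
Hypothesis hG : subgroup G.

Lemma subgroupN x : G x -> G (- x).
Proof. by case: hG => G0 GB Gx; rewrite -sub0r; apply: GB. Qed.

Lemma subgroupD x y : G x -> G y -> G (x + y).
Proof.
by move=> Gx Gy; rewrite -[y]opprK; apply: hG.2 => //; apply: subgroupN.
Qed.

Lemma subgroupMz x (c : int) : G x -> G (x *~ c).
Proof.
move=> Gx; have Mn n : G (x *+ n).
  elim: n => [|n IHn]; first by rewrite mulr0n; apply: hG.1.
  by rewrite mulrS; apply: subgroupD.
by case: c => n; [exact: Mn | apply: subgroupN; exact: Mn].
Qed.

Lemma subgroup_sum n (F : 'I_n -> V) : (forall i, G (F i)) -> G (\sum_i F i).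
Proof.
move=> GF; elim/big_ind: _ => //; first exact: hG.1.
exact: subgroupD.
Qed.

End Subgroup.

(** The image is generated by its least positive element, as division with
    remainder stays inside the image. *)
Lemma int_image_principal (V : zmodType) (G : V -> Prop)
    (f : {additive V -> rat}) :
  subgroup G -> (forall x, G x -> f x \is a Num.int) ->
  (exists2 x, G x & f x != 0) ->
  exists2 x0, G x0 /\ f x0 != 0 &
    forall x, G x -> exists q : int, f x = f x0 *~ q.
Proof.
move=> hG fZ [x1 Gx1 fx1].
(* The index is shifted by one so that [P] only sees positive values. *)
pose P (m : nat) := exists2 x, G x & f x = m.+1%:R.
have posP x : G x -> 0 < f x -> exists2 m : nat, P m & f x = m.+1%:R.
  move=> Gx fx; have /natrP[[|m] fm] : f x \is a Num.nat.
  - by rewrite natrEint fZ // ltW.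
  - by rewrite fm ltxx in fx.
  - by exists m => //; exists x.
have [m Pm] : exists m, P m.
  case: (ltrgt0P (f x1)) fx1 => // fx1 _.
    by have [m ? _] := posP _ Gx1 fx1; exists m.
  have [|m ? _] := posP _ (subgroupN hG Gx1); last by exists m.
  by rewrite raddfN oppr_gt0.
have [d [[[x0 Gx0 fx0] dmin] _]] :=
  dec_inh_nat_subset_has_unique_least_element P (fun n => classic (P n))
    (ex_intro _ m Pm).
exists x0 => [|x Gx]; first by split=> //; rewrite fx0 pnatr_eq0.
have /intrP[a fa] := fZ x Gx.
exists (a %/ d.+1)%Z; apply/eqP.
rewrite -[f x0 *~ _]raddfMz -subr_eq0 -raddfB.
have fr : f (x - x0 *~ (a %/ d.+1)%Z) = (a %% d.+1)%Z%:~R.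
  rewrite raddfB raddfMz fa fx0 {1}(divz_eq a d.+1) intrD intrM.
  by rewrite -mulrzl mulrC; ring.
have := ltz_mod a (isT : d.+1%:Z != 0).
have := modz_ge0 a (isT : d.+1%:Z != 0).
rewrite fr intr_eq0 le_eqVlt => /orP[/eqP <- //|r0] rd.
have [|e Pe fe] := posP _ (hG.2 _ _ Gx (subgroupMz hG (a %/ d.+1)%Z Gx0)).
  by rewrite fr ltr0z.
have := dmin e Pe.
move: fe; rewrite fr -[e.+1%:R]/(e.+1%:Z%:~R) => /eqP.
rewrite eqr_int => /eqP er; move: rd; rewrite er; lia.
Qed.

(** By induction on the list of coordinates: a basis of the kernel of the first
    coordinate, extended by an element of [G] on which that coordinate generates
    its image, is a basis of [G]. *)
Lemma is_lattice_of_coordinates (V : lmodType rat) (I : eqType) (s : seq I)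
    (f : I -> {additive V -> rat}) (G : V -> Prop) :
  subgroup G ->
  (forall i x, i \in s -> G x -> f i x \is a Num.int) ->
  (forall x, G x -> (forall i, i \in s -> f i x = 0) -> x = 0) ->
  is_lattice G.
Proof.
elim: s G => [|i s IHs] G hG fZ f0.
  exists 0%N, (fun _ => 0); split=> [x|c _ []//].
  split=> [Gx|[c ->]]; last by rewrite big_ord0; apply: hG.1.
  by exists (fun _ => 0); rewrite big_ord0; apply: f0 => // j.
pose K x := G x /\ f i x = 0.
have hK : subgroup K.
  split=> [|x y [Gx fx] [Gy fy]]; first by split; [apply: hG.1|rewrite raddf0].
  by split; [apply: hG.2|rewrite raddfB fx fy subrr].
have [||n [e [eK efree]]] := IHs K hK.
- by move=> j x js [Gx _]; apply: fZ => //; rewrite inE js orbT.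
- move=> x [Gx fx] fs; apply: f0 => // j; rewrite inE => /orP[/eqP->//|].
  exact: fs.
have [hf|nf] := classic (exists2 x, G x & f i x != 0); last first.
  exists n, e; split=> // x; rewrite -eK; split=> [Gx|[]//].
  by split=> //; apply/eqP/negPn/negP => fx; apply: nf; exists x.
have [|x0 [Gx0 fx0] gen] := int_image_principal hG _ hf.
  by move=> x; apply: fZ; rewrite inE eqxx.
have Ke j : K (e j).
  (* the j-th basis vector is the combination with Kronecker coefficients *)
  apply/eK; exists (fun h => (h == j)%:Z).
  rewrite (bigD1 j) //= eqxx mulr1z big1 ?addr0 // => h /negPf ->.
  by rewrite mulr0z.
pose e' (j : 'I_n.+1) := oapp e x0 (unlift ord0 j).
have sumE (c : 'I_n.+1 -> int) : \sum_j e' j *~ c j =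
    x0 *~ c ord0 + \sum_j e j *~ c (lift ord0 j).
  rewrite big_ord_recl /e' unlift_none; congr (_ + _).
  by apply: eq_bigr => j _; rewrite liftK.
exists n.+1, e'; split=> [x|c].
  split=> [Gx|[c ->]].
    have [q fx] := gen x Gx.
    have /eK[c xc] : K (x - x0 *~ q).
      split; first by apply: hG.2 => //; apply: subgroupMz.
      by rewrite raddfB raddfMz fx subrr.
    exists (fun j => oapp c q (unlift ord0 j)).
    rewrite sumE unlift_none /=.
    under eq_bigr do rewrite liftK.
    by rewrite /= -xc addrC subrK.
  rewrite sumE; apply: subgroupD => //; first exact: subgroupMz.
  by apply: subgroup_sum => // j; apply: subgroupMz => //; case: (Ke j).
rewrite sumE => c0.
have ks : K (\sum_j e j *~ c (lift ord0 j)).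
  by apply: subgroup_sum => // j; apply: subgroupMz.
have c00 : c ord0 = 0.
  have := congr1 (f i) c0; rewrite raddfD raddf0 raddfMz ks.2 addr0.
  by move/eqP; rewrite mulrz_eq0 (negPf fx0) orbF => /eqP.
rewrite c00 mulr0z add0r in c0.
move=> j; case: (unliftP ord0 j) => [h ->|-> //]; exact: efree c0 h.
Qed.

(** * The form on the cosets of N *)

(** In coordinates [2 j lambda_k = (j / k) gamma - j alpha_k], whose entries sum
    to [0]; subtracting it leaves an integral vector of sum zero exactly under
    the two conditions on the right. *)
Lemma cosetNP k (j : int) (x : 'rV[rat]_k) : (0 < k)%N ->
  cosetN j x <->
  (forall i, x 0 i - j%:~R / k%:R \is a Num.int) /\ \sum_i x 0 i = 0.
Proof.
move=> k0; have kn0 : k%:R != 0 :> rat by rewrite pnatr_eq0 -lt0n.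
have lE i : ((2 * j)%:~R *: lambda k) 0 i =
    j%:~R / k%:R - j%:~R * (i.+1 == k)%:R.
  by rewrite !mxE gammaE !intrM; field.
have sl : \sum_i ((2 * j)%:~R *: lambda k) 0 i = 0.
  under eq_bigr do rewrite lE.
  rewrite sumrB sumr_const card_ord -mulr_sumr.
  have -> : \sum_(i < k) (i.+1 == k)%:R = 1 :> rat.
    case: k k0 {kn0 lE x} => // n _; rewrite big_ord_recr /= eqxx.
    by rewrite big1 ?add0r // => i _; rewrite eqSS ltn_eqF.
  by rewrite -[_ *+ k]mulr_natr divfK // mulr1 subrr.
split=> [[y /latNP[yZ sy] ->]|[xZ sx]].
  split=> [i|].
    rewrite mxE lE addrA addrAC addrK rpredB // rpredM ?intr_int //.
    exact: natr_int.
  under eq_bigr do rewrite mxE.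
  by rewrite big_split /= sy sl addr0.
exists (x - (2 * j)%:~R *: lambda k); last by rewrite subrK.
apply/latNP; split=> [i|].
  rewrite mxE [X in _ + X]mxE lE opprB addrA addrAC rpredD //.
  by rewrite rpredM ?intr_int ?natr_int.
under eq_bigr do rewrite mxE [X in _ + X]mxE.
by rewrite sumrB sx sl subrr.
Qed.

(** The integer [m] is the standard product of the integral vectors
    [x - (i / k) gamma] and [y - (j / k) gamma]. *)
Lemma form_cosetN k (i j : int) (x y : 'rV[rat]_k) : (0 < k)%N ->
  cosetN i x -> cosetN j y ->
  exists m : int, Defs.form x y = 2 * (m%:~R - (i * j)%:~R / k%:R).
Proof.
move=> k0 /(cosetNP _ _ k0)[xZ sx] /(cosetNP _ _ k0)[yZ sy].
have kn0 : k%:R != 0 :> rat by rewrite pnatr_eq0 -lt0n.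
set a := i%:~R / k%:R in xZ; set b := j%:~R / k%:R in yZ.
have /intrP[m mE] : \sum_(h < k) (x 0 h - a) * (y 0 h - b) \is a Num.int.
  by apply: rpred_sum => h _; rewrite rpredM.
exists m; rewrite -mE /Defs.form; congr (_ * _).
have -> : \sum_(h < k) (x 0 h - a) * (y 0 h - b) =
    \sum_(h < k) x 0 h * y 0 h - a * \sum_(h < k) y 0 h
    - b * \sum_(h < k) x 0 h + a * b *+ k.
  have <- : \sum_(h < k) a * b = a * b *+ k by rewrite sumr_const card_ord.
  rewrite !mulr_sumr -!sumrB -big_split /=.
  by apply: eq_bigr => h _; ring.
by rewrite sx sy !mulr0 !subr0 -mulr_natr /a /b intrM; field.
Qed.

(** * The form on Gamma_D and the code D *)

Section GammaCode.
Variables (k l : nat).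
Hypothesis k1 : (1 < k)%N.
Implicit Types (xi eta : 'rV['Z_k]_l) (x y : 'M[rat]_(l, k)).

(** A lift of [code_dot] to the natural numbers, needed because the form only
    sees the code product after division by [k] in the rationals. *)
Definition dot_lift xi eta : nat := (\sum_(r < l) xi 0%R r * eta 0%R r)%N.

Lemma code_dot_lift xi eta : code_dot xi eta = (dot_lift xi eta)%:R.
Proof.
rewrite natr_sum; apply: eq_bigr => r _.
by rewrite natrM !natr_Zp.
Qed.

(** The polarization identity that makes isotropic codes integral. *)
Lemma code_dot_polarization xi eta : code_dot (xi - eta) (xi - eta) =
  code_dot xi xi - code_dot xi eta *+ 2 + code_dot eta eta.
Proof.
rewrite /code_dot -sumrMnl -sumrB -big_split /=.
by apply: eq_bigr => r _; rewrite !mxE; ring.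
Qed.

Lemma Zp_natr_eq0 n : (n%:R == 0 :> 'Z_k) = (k %| n)%N.
Proof. by rewrite -val_eqE /= val_Zp_nat. Qed.

Lemma formM_latNxi xi eta x y : latNxi xi x -> latNxi eta y ->
  exists m : int, formM x y = 2 * (m%:~R - (dot_lift xi eta)%:R / k%:R).
Proof.
move=> xP yP.
have F (r : 'I_l) : exists m : int,
    Defs.form (row r x) (row r y) =
    2 * (m%:~R - (xi 0%R r * eta 0%R r)%N%:R / k%:R).
  have [m ->] := form_cosetN (ltnW k1) (xP r) (yP r).
  by exists m; rewrite -PoszM.
have [m mE] := fin_all_exists F.
exists (\sum_r m r); rewrite /formM (eq_bigr _ (fun r _ => mE r)).
by rewrite -mulr_sumr sumrB -mulr_suml -natr_sum -rmorph_sum.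
Qed.

Lemma latNxi_nonempty xi : exists x, latNxi xi x.
Proof.
exists (\matrix_r ((2 * (xi 0 r : nat)%:Z)%:~R *: lambda k)) => r.
rewrite rowK; exists 0; last by rewrite add0r.
apply/latNP; split=> [i|]; first by rewrite mxE.
by rewrite big1 // => i _; rewrite mxE.
Qed.

Lemma int_sub_divk (m : int) (n : nat) :
  (m%:~R - n%:R / k%:R : rat) \is a Num.int = (k %| n)%N.
Proof.
have kn0 : k%:R != 0 :> rat by rewrite pnatr_eq0 -lt0n ltnW.
rewrite rpredBl ?intr_int //; apply/idP/idP => [/intrP[c cE]|/dvdnP[c ->]].
  have {}cE : n%:~R = (c * k)%:~R :> rat.
    by rewrite intrM -cE -[k%:~R]/(k%:R) divfK.
  have /dvdzP : exists c, n%:Z = c * k%:Z.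
    by exists c; apply/eqP; rewrite -(eqr_int rat) cE.
  by [].
by rewrite natrM mulfK ?natr_int.
Qed.

Lemma formM_int xi eta x y : latNxi xi x -> latNxi eta y ->
  (formM x y \is a Num.int) = (code_dot xi eta *+ 2 == 0).
Proof.
move=> xP yP; have [m ->] := formM_latNxi xP yP.
rewrite code_dot_lift -mulrnA Zp_natr_eq0 -(int_sub_divk (2 * m)).
by congr (_ \is a _); rewrite intrM natrM; ring.
Qed.

Lemma formM_even xi x : latNxi xi x ->
  (exists m : int, formM x x = 2 * m%:~R) <-> code_dot xi xi = 0.
Proof.
move=> xP; have [m ->] := formM_latNxi xP xP.
have -> : (code_dot xi xi = 0) <-> (m%:~R - (dot_lift xi xi)%:R / k%:R : rat)
    \is a Num.int.
  by rewrite int_sub_divk -Zp_natr_eq0 -code_dot_lift; split=> /eqP.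
split=> [[c /mulfI ->]|/intrP[c ->]]; [exact: intr_int|by []|by exists c].
Qed.

Lemma formM_positive (G : 'M[rat]_(l, k) -> Prop) :
  positive_definite (@formM k l) G.
Proof.
have sq0 x r i : 0 <= row r x 0 i * row r x 0 i.
  by rewrite -expr2 sqr_ge0.
have f0 x r : 0 <= Defs.form (row r x) (row r x).
  by rewrite mulr_ge0 // sumr_ge0.
move=> x _ xn0; rewrite lt_neqAle sumr_ge0 // andbT eq_sym.
apply: contra xn0 => /eqP/(psumr_eq0P (fun r _ => f0 x r)) x0.
apply/eqP/matrixP => r i; have /eqP := x0 r isT.
rewrite mulf_eq0 /= => /eqP/(psumr_eq0P (fun i _ => sq0 x r i))/(_ i isT)/eqP.
by rewrite !mxE mulf_eq0 orbb => /eqP.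
Qed.

(** Representatives in [0, k[ are additive only modulo [k], which is all that
    the cosets of [N] depend on. *)
Lemma Zp_subz_mod (u v : 'Z_k) :
  ((u : nat)%:Z - (v : nat)%:Z = ((u - v)%R : nat)%:Z %[mod k])%Z.
Proof.
have vk : (v <= k)%N by rewrite ltnW // -{2}(Zp_cast k1).
have E : (((u - v)%R : nat) + v = u %[mod k])%N.
  rewrite /=; move: (nat_of_ord u) (nat_of_ord v) vk => a b bk.
  by rewrite Zp_cast // modnDml addnAC modnDmr -addnA subnKC // modnDr.
have : ((((u - v)%R : nat) + v)%N%:Z == (u : nat)%:Z %[mod k])%Z.
  by rewrite !modz_nat E.
rewrite eqz_mod_dvd -rpredN => dv; apply/eqP; rewrite eqz_mod_dvd.
by rewrite PoszD opprB opprD addrA addrAC in dv.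
Qed.

Lemma GammaD_subgroup (D : {set 'rV['Z_k]_l}) :
  zmod_closed D -> subgroup (GammaD D).
Proof.
move=> [D0 DB]; split.
  exists 0 => // r; apply/(cosetNP _ _ (ltnW k1)); split=> [i|].
    by rewrite !mxE mul0r subrr.
  by rewrite big1 // => i _; rewrite !mxE.
move=> x y [xi xiD xP] [eta etaD yP]; exists (xi - eta); first exact: DB.
move=> r; apply: (@cosetN_mod _ ((xi 0 r : nat)%:Z - (eta 0 r : nat)%:Z)).
- exact: ltnW.
- by rewrite !mxE; apply: Zp_subz_mod.
have /(cosetNP _ _ (ltnW k1))[xZ sx] := xP r.
have /(cosetNP _ _ (ltnW k1))[yZ sy] := yP r.
apply/(cosetNP _ _ (ltnW k1)); split=> [i|].
  have -> : row r (x - y) 0 i - ((xi 0 r : nat)%:Z - (eta 0 r : nat)%:Z)%:~R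
      / k%:R = (row r x 0 i - (xi 0 r : nat)%:Z%:~R / k%:R)
             - (row r y 0 i - (eta 0 r : nat)%:Z%:~R / k%:R) :> rat.
    by rewrite !mxE intrB; ring.
  exact: rpredB.
under eq_bigr do rewrite raddfB mxE [X in _ + X]mxE.
by rewrite sumrB sx sy subrr.
Qed.

(** Entries of elements of Gamma_D have denominators dividing [k]. *)
Definition scaled_entry (p : 'I_l * 'I_k) x : rat := k%:R * x p.1 p.2.

Lemma scaled_entry_is_zmod_morphism p : zmod_morphism (scaled_entry p).
Proof. by move=> x y; rewrite /scaled_entry !mxE mulrBr. Qed.

HB.instance Definition _ p := GRing.isZmodMorphism.Build 'M[rat]_(l, k) rat
  (scaled_entry p) (scaled_entry_is_zmod_morphism p).

Lemma GammaD_lattice (D : {set 'rV['Z_k]_l}) :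
  zmod_closed D -> is_lattice (GammaD D).
Proof.
have kn0 : k%:R != 0 :> rat by rewrite pnatr_eq0 -lt0n ltnW.
move=> hD; apply: (@is_lattice_of_coordinates _ _ (enum {: 'I_l * 'I_k})
    scaled_entry) => [|[r i] x _ [xi _ xP]|x _ x0].
- exact: GammaD_subgroup.
- have /(cosetNP _ _ (ltnW k1))[/(_ i)] := xP r.
  rewrite mxE => /intrP[m mE] _.
  rewrite /= /scaled_entry /=.
  have -> : k%:R * x r i = k%:R * m%:~R + (xi 0 r : nat)%:R.
    by rewrite -mE mulrBr mulrCA divff // mulr1 subrK.
  by rewrite rpredD ?rpredM ?intr_int ?natr_int.
apply/matrixP => r i; rewrite mxE; apply/eqP.
have /eqP := x0 (r, i) (mem_enum _ _).
by rewrite mulf_eq0 (negPf kn0).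
Qed.

End GammaCode.

(** With the representative of [d] below [k], twice it is a multiple of [k] only
    if it is [0] or [k] itself. *)
Lemma Zp_double_eq0 k (d : 'Z_k) : (1 < k)%N ->
  d *+ 2 = 0 <-> d = 0 \/ ~~ odd k /\ d = (k %/ 2)%:R.
Proof.
move=> k1; split=> [/eqP|[->|[kev ->]]]; last first.
- apply/eqP; rewrite -mulrnA Zp_natr_eq0 //.
  by rewrite divnK ?dvdn2.
- by rewrite mul0rn.
have dk : (d < k)%N by rewrite -{2}(Zp_cast k1).
rewrite -[d]natr_Zp -mulrnA Zp_natr_eq0 // => /dvdnP[[|[|q]] dq].
- by left; have -> : (d : nat) = 0%N by lia.
- by right; split; [lia | have -> : (k %/ 2)%N = d by lia].
by exfalso; nia.
Qed.

Theorem lemma7p1 (k l : nat) (hk : (2 <= k)%N) (hl : (1 <= l)%N)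
    (D : {set 'rV['Z_k]_l}) (hD : zmod_closed D) :
  (positive_definite (@formM k l) (GammaD D) /\
     even_lattice (@formM k l) (GammaD D) <->
   forall xi, xi \in D -> code_dot xi xi = 0) /\
  (positive_definite (@formM k l) (GammaD D) /\
     odd_lattice (@formM k l) (GammaD D) <->
   [/\ ~~ odd k,
       forall xi eta, xi \in D -> eta \in D ->
         code_dot xi eta = 0 \/ code_dot xi eta = (k %/ 2)%:R
     & exists2 xi, xi \in D & code_dot xi xi = (k %/ 2)%:R]).
Proof.
have posD := @formM_positive k l (GammaD D).
have intD : integral_lattice (@formM k l) (GammaD D) <->
    forall xi eta, xi \in D -> eta \in D -> code_dot xi eta *+ 2 = 0.
  split=> [[_ bZ] xi eta xiD etaD|dot2].
    have [x xP] := latNxi_nonempty xi; have [y yP] := latNxi_nonempty eta.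
    apply/eqP; rewrite -(formM_int hk xP yP).
    by apply: bZ; [exists xi|exists eta].
  split=> [|x y [xi xiD xP] [eta etaD yP]]; first exact: GammaD_lattice.
  by rewrite (formM_int hk xP yP) dot2.
have evenD : integral_lattice (@formM k l) (GammaD D) ->
    even_lattice (@formM k l) (GammaD D) <->
    forall xi, xi \in D -> code_dot xi xi = 0.
  move=> iD; split=> [[_ ev] xi xiD|dot0].
    have [x xP] := latNxi_nonempty xi.
    by apply/(formM_even hk xP)/ev; exists xi.
  split=> // x [xi xiD xP]; exact/(formM_even hk xP)/dot0.
have isotropic_int : (forall xi, xi \in D -> code_dot xi xi = 0) ->
    integral_lattice (@formM k l) (GammaD D).
  move=> dot0; apply/intD => xi eta xiD etaD.
  have := dot0 (xi - eta) (hD.2 _ _ xiD etaD).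
  rewrite code_dot_polarization dot0 // dot0 // addr0 sub0r => /eqP.
  by rewrite oppr_eq0 => /eqP.
split.
  split=> [[_ ev]|dot0]; first by apply/evenD => //; case: ev.
  by split=> //; apply/evenD => //; apply: isotropic_int.
split=> [[_ [iD nev]]|[kev dotk [xi xiD xixi]]].
  have dot2 := intD.1 iD.
  have [xi xiD xin0] : exists2 xi, xi \in D & code_dot xi xi != 0.
    apply: NNPP => nD; apply: nev; apply/evenD => // xi xiD.
    by apply/eqP/negPn/negP => xi0; apply: nD; exists xi.
  have [xi0|[kev xixi]] := (Zp_double_eq0 _ hk).1 (dot2 _ _ xiD xiD).
    by rewrite xi0 eqxx in xin0.
  split=> //; last by exists xi.
  move=> zeta eta zetaD etaD.
  by have [->|[_ ->]] := (Zp_double_eq0 _ hk).1 (dot2 _ _ zetaD etaD); auto.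
have iD : integral_lattice (@formM k l) (GammaD D).
  apply/intD => zeta eta zetaD etaD; apply/(Zp_double_eq0 _ hk).
  by case: (dotk _ _ zetaD etaD); auto.
(* the given codeword has norm k/2, which is nonzero in Z_k as 0 < k/2 < k *)
split=> //; split=> // /(evenD iD)/(_ xi xiD)/eqP.
by rewrite xixi Zp_natr_eq0 // gtnNdvd //; lia.
Qed.
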